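(* Let $u$ be a power of $2$ and let $P$ be a set of $n$ points on the $u \times u$ integer grid. Suppose $P$ can be covered by $c$ clusters $C_1,\dots,C_c \subseteq P$ (so $P = C_1 \cup \dots \cup C_c$, the clusters not necessarily disjoint), where cluster $C_i$ has $n_i$ points and diameter $\ell_i$. Then the quadtree of $P$ has $O\!\left(c \log u + \sum_{i=1}^{c} n_i \log \ell_i\right)$ nodes.
   Context: The quadtree of a point set $P$ on a $u\times u$ grid ($u$ a power of $2$) is defined recursively: if the grid contains $0$ points of $P$ (resp. all $u^2$ of its cells belong to $P$), the quadtree is a single root node storing $0$ (resp. $1$); otherwise the root stores $1$ and has four children, which are the quadtrees of the four $(u/2)\times(u/2)$ quadrants of the grid (in the order top-left, top-right, bottom-left, bottom-right) with respect to the points of $P$ lying in them. The quadtree has height at most $\lg u$, and a node at depth $d$ corresponds to an aligned $2^{\lg u - d}\times 2^{\lg u-d}$ square of the grid. *)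

(* Defs.v *)
From HB Require Import structures.
From mathcomp Require Import all_boot all_order all_algebra.
From mathcomp Require Import reals exp.
Set Implicit Arguments.
Unset Strict Implicit.
Unset Printing Implicit Defensive.
Import Order.TTheory GRing.Theory Num.Theory.

(* The points of the u x u grid, u = 2 ^ k, as (row, column) pairs; row 0 is
   the top row and column 0 the leftmost one. *)
Definition grid (k : nat) : finType := ('I_(2 ^ k) * 'I_(2 ^ k))%type.

(* The four subtrees are in the order top-left, top-right, bottom-left,
   bottom-right; the boolean is the bit stored at the node. *)
Inductive qtree : Type :=
| QLeaf of bool
| QNode of bool & qtree & qtree & qtree & qtree.

Fixpoint num_nodes (t : qtree) : nat :=
  match t with
  | QLeaf _ => 1
  | QNode _ tl tr bl br =>
      (num_nodes tl + num_nodes tr + num_nodes bl + num_nodes br).+1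
  end.

Section Quadtree.
Variables (k : nat) (P : {set grid k}).

(* The points of P in the 2 ^ j x 2 ^ j square with top-left cell (r, c). *)
Definition points_in (j r c : nat) : {set grid k} :=
  [set p in P | (r <= p.1 < r + 2 ^ j) && (c <= p.2 < c + 2 ^ j)].

(* The quadtree of that square. For j = 0 the last branch is never reached: a
   single cell contains either 0 points or all its 1 cells. *)
Fixpoint quadtree_at (j r c : nat) : qtree :=
  if #|points_in j r c| == 0 then QLeaf false
  else if #|points_in j r c| == 2 ^ j * 2 ^ j then QLeaf true
  else if j is j'.+1 then
    let h := 2 ^ j' in
    QNode true (quadtree_at j' r c) (quadtree_at j' r (c + h))
      (quadtree_at j' (r + h) c) (quadtree_at j' (r + h) (c + h))
  else QLeaf true.

Definition quadtree : qtree := quadtree_at k 0 0.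

End Quadtree.

Local Open Scope ring_scope.

Definition dist (R : realType) (k : nat) (p q : grid k) : R :=
  Num.sqrt ((p.1%:R - q.1%:R) ^+ 2 + (p.2%:R - q.2%:R) ^+ 2).

(* Euclidean. It is 0 when C has at most one point and at least 1 otherwise, so
   with [ln 0 = 0] (lemma [ln0]) the quantity [ln (diameter R C)] is always
   nonnegative and a cluster with one point contributes 0 to a sum of terms
   [#|C|%:R * ln (diameter R C)]. *)
Definition diameter (R : realType) (k : nat) (C : {set grid k}) : R :=
  \big[Num.max/0]_(p in C) \big[Num.max/0]_(q in C) dist R p q.

(* Main.v *)
(* An internal node of the quadtree is an aligned square of side 2 ^ i, with
   1 <= i <= k, that meets P. A cluster of diameter at most 2 ^ i meets at most
   four such squares, and any cluster meets at most as many as it has points.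
   Since at most log2 l indices i >= 1 satisfy 2 ^ i < l, a cluster with n
   points and diameter l accounts for at most 4 k + n log2 l internal nodes. *)
Require Import Defs.
From HB Require Import structures.
From mathcomp Require Import all_boot all_order all_algebra.
From mathcomp Require Import reals exp.
From mathcomp Require Import zify lra.
Import Order.TTheory GRing.Theory Num.Theory.
Local Open Scope ring_scope.

(** * Counting the aligned squares that meet a point set *)

Section Cells.
Set Implicit Arguments.
Unset Strict Implicit.
Local Open Scope nat_scope.
Variable k : nat.

Lemma cell_subproof (i : nat) (x : 'I_(2 ^ k)) : x %/ 2 ^ i < 2 ^ k.
Proof. exact: leq_ltn_trans (leq_div _ _) (ltn_ord x). Qed.

(** Index of the aligned square of side [2 ^ i] containing [p], kept in [grid k] so that all scales
    share one finite type; [#|cell i @: C|] counts the squares of that side that meet [C]. *)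
Definition cell (i : nat) (p : grid k) : grid k :=
  (Ordinal (cell_subproof i p.1), Ordinal (cell_subproof i p.2)).

Lemma square_range (s a x : nat) :
  0 < s -> (a * s <= x < a * s + s) = (x %/ s == a).
Proof.
by move=> s0; rewrite eqn_leq leq_divRL // -(ltnS (_ %/ _)) ltn_divLR // mulSnr andbC.
Qed.

Lemma sum_children (a b m n : nat) :
  ((m == a.*2) && (n == b.*2)) + ((m == a.*2) && (n == b.*2.+1))
  + ((m == a.*2.+1) && (n == b.*2)) + ((m == a.*2.+1) && (n == b.*2.+1))
  <= (m %/ 2 == a) && (n %/ 2 == b).
Proof. by do ![case: eqP => ?]; lia. Qed.

(** For [i <= j], this is the number of squares of side [2 ^ i] that meet [P] and lie in the square
    of side [2 ^ j] with index [(a, b)]. *)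
Definition cells_in (P : {set grid k}) (j a b i : nat) : nat :=
  \sum_(q in cell i @: P)
    ((q.1 %/ 2 ^ (j - i) == a) && (q.2 %/ 2 ^ (j - i) == b)).

Lemma cells_in_children (P : {set grid k}) (j a b i : nat) : i <= j ->
  cells_in P j a.*2 b.*2 i + cells_in P j a.*2 b.*2.+1 i
  + cells_in P j a.*2.+1 b.*2 i + cells_in P j a.*2.+1 b.*2.+1 i
  <= cells_in P j.+1 a b i.
Proof.
move=> ij; rewrite /cells_in -!big_split /=; apply: leq_sum => q _.
by rewrite subSn // expnSr !divnMA; exact: sum_children.
Qed.

(** A tree in which every internal node has four children has four times as many nodes as internal
    nodes, plus one. Each internal node is charged to its own nonempty square. *)
Lemma num_nodes_quadtree_at (P : {set grid k}) (j a b : nat) :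
  num_nodes (quadtree_at P j (a * 2 ^ j) (b * 2 ^ j)) <=
    (4 * \sum_(1 <= i < j.+1) cells_in P j a b i).+1.
Proof.
elim: j a b => [|j IH] a b /=; first by case: ifP => _ //; case: ifP.
case: ifPn => //; rewrite -lt0n => /card_gt0P[p].
rewrite inE !square_range ?expn_gt0 // => /andP[pP pab].
case: ifP => //= _; rewrite big_nat_recr //=.
(* The square itself is counted at scale [j.+1]; this pays for the four [+1] terms of the
   subtrees. *)
have top : 0 < cells_in P j.+1 a b j.+1.
  rewrite /cells_in subnn (bigD1 (cell j.+1 p)) ?imset_f //=.
  by rewrite expn0 !divn1 pab.
have even x : x * 2 ^ j.+1 = x.*2 * 2 ^ j by rewrite expnS; lia.
have odd x : x.*2 * 2 ^ j + 2 ^ j = x.*2.+1 * 2 ^ j by rewrite mulSn addnC.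
rewrite !even !odd.
have sub : \sum_(1 <= i < j.+1) cells_in P j a.*2 b.*2 i
    + \sum_(1 <= i < j.+1) cells_in P j a.*2 b.*2.+1 i
    + \sum_(1 <= i < j.+1) cells_in P j a.*2.+1 b.*2 i
    + \sum_(1 <= i < j.+1) cells_in P j a.*2.+1 b.*2.+1 i
    <= \sum_(1 <= i < j.+1) cells_in P j.+1 a b i.
  rewrite -!big_split /=; rewrite big_nat_cond [leqRHS]big_nat_cond.
  apply: leq_sum => i; rewrite andbT => /andP[_ ij].
  exact: cells_in_children.
have h1 := IH a.*2 b.*2; have h2 := IH a.*2 b.*2.+1.
have h3 := IH a.*2.+1 b.*2; have h4 := IH a.*2.+1 b.*2.+1.
lia.
Qed.

Lemma num_nodes_quadtree (P : {set grid k}) :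
  num_nodes (quadtree P) <= (4 * \sum_(1 <= i < k.+1) #|cell i @: P|).+1.
Proof.
have := num_nodes_quadtree_at P k 0 0; rewrite !mul0n => /leq_trans; apply.
rewrite ltnS leq_mul2l /=; apply: leq_sum => i _.
by rewrite -sum1_card; apply: leq_sum => q _; case: (_ && _).
Qed.

Lemma card_cell_bigcup (c : nat) (C : 'I_c -> {set grid k}) (i : nat) :
  #|cell i @: \bigcup_(l < c) C l| <= \sum_(l < c) #|cell i @: C l|.
Proof.
elim/big_rec2: _ => [|l n A _ le_n]; first by rewrite imset0 cards0.
rewrite imsetU (leq_trans (leq_card_setU _ _)) //.
by rewrite leq_add2l.
Qed.

Lemma divn_near (s x y : nat) : 0 < s -> x <= y + s -> x %/ s <= (y %/ s).+1.
Proof.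
move=> s0 xy; apply: leq_trans (leq_div2r s xy) _.
by rewrite divnDr // divnn s0 addn1.
Qed.

Lemma near_inj (m x y : nat) :
  m <= x -> m <= y -> x <= m.+1 -> y <= m.+1 -> (x == m) = (y == m) -> x = y.
Proof. lia. Qed.

(** Square rows take only their minimal value and its successor, and so do square columns, so two
    booleans identify a square. *)
Lemma card_cell_close (C : {set grid k}) (i : nat) :
  {in C &, forall p q : grid k, (p.1 <= q.1 + 2 ^ i) && (p.2 <= q.2 + 2 ^ i)} ->
  #|cell i @: C| <= 4.
Proof.
move=> close.
have [->|[p0 p0C]] := set_0Vmem C; first by rewrite imset0 cards0.
(* The least row and the least column may be attained at different points. *)
have [p1 p1C min1] := arg_minnP (fun p : grid k => p.1 %/ 2 ^ i) p0C.
have [p2 p2C min2] := arg_minnP (fun p : grid k => p.2 %/ 2 ^ i) p0C.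
pose f (q : grid k) := (q.1 == p1.1 %/ 2 ^ i :> nat, q.2 == p2.2 %/ 2 ^ i :> nat).
have s0 : 0 < 2 ^ i by rewrite expn_gt0.
have finj : {in cell i @: C &, injective f}.
  move=> _ _ /imsetP[p pC ->] /imsetP[q qC ->] [].
  have /andP[/(divn_near s0) a1 _] := close _ _ pC p1C.
  have /andP[/(divn_near s0) a2 _] := close _ _ qC p1C.
  have /andP[_ /(divn_near s0) a3] := close _ _ pC p2C.
  have /andP[_ /(divn_near s0) a4] := close _ _ qC p2C.
  have b1 := min1 _ pC; have b2 := min1 _ qC.
  have b3 := min2 _ pC; have b4 := min2 _ qC.
  by move=> /= e1 e2; congr pair; apply: val_inj => /=;
    [exact: near_inj e1|exact: near_inj e2].
rewrite -(card_in_imset finj) (leq_trans (max_card _)) //.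
by rewrite card_prod card_bool.
Qed.

End Cells.

(** * Diameters and the scales below them *)

Section Diameter.
Set Implicit Arguments.
Unset Strict Implicit.
Variables (R : realType) (k : nat).
Implicit Types (C : {set grid k}) (p q : grid k).

Lemma dist_le_diameter C : {in C &, forall p q, dist R p q <= diameter R C}.
Proof.
move=> p q pC qC; rewrite /diameter.
apply: le_trans (le_bigmax_cond _ _ pC).
exact: (le_bigmax_cond _ (fun q => dist R p q)).
Qed.

Lemma norm_sub_le_dist p q :
  (`|p.1%:R - q.1%:R| <= dist R p q) && (`|p.2%:R - q.2%:R| <= dist R p q).
Proof.
by rewrite -!sqrtr_sqr !ler_wsqrtr // ?lerDl ?lerDr sqr_ge0.
Qed.

(** Distinct integer coordinates differ by at least 1. This excludes diameters in [(0, 1)], where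
    [ln] is negative. *)
Lemma dist_eq0_or_ge1 p q : (dist R p q == 0) || (1 <= dist R p q).
Proof.
have sub_ge1 (x y : nat) : x != y -> 1 <= `|x%:R - y%:R| :> R.
  by case: ltngtP => // xy _; [rewrite distrC|];
    rewrite -natrB ?(ltnW xy) // normr_nat ler1n subn_gt0.
have /andP[d1 d2] := norm_sub_le_dist p q.
have [e1|/sub_ge1 n1] := eqVneq (p.1 : nat) q.1; last first.
  by rewrite (le_trans n1 d1) orbT.
have [e2|/sub_ge1 n2] := eqVneq (p.2 : nat) q.2; last first.
  by rewrite (le_trans n2 d2) orbT.
by rewrite /dist e1 e2 !subrr expr0n addr0 sqrtr0 eqxx.
Qed.

Lemma ln_diameter_ge0 C : 0 <= ln (diameter R C).
Proof.
have max01 (x y : R) : (x == 0) || (1 <= x) -> (y == 0) || (1 <= y) ->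
    (Num.max x y == 0) || (1 <= Num.max x y).
  by move=> hx hy; case: (leP x y).
have : (diameter R C == 0) || (1 <= diameter R C).
  rewrite /diameter; apply: (big_ind (fun x : R => (x == 0) || (1 <= x))) => //.
    by rewrite eqxx.
  move=> p _; apply: (big_ind (fun x : R => (x == 0) || (1 <= x))) => //.
    by rewrite eqxx.
  by move=> q _; exact: dist_eq0_or_ge1.
by case/orP => [/eqP->|]; [rewrite ln0|exact: ln_ge0].
Qed.

Lemma card_cell_small_diameter C (i : nat) :
  diameter R C <= (2 ^ i)%N%:R -> (#|cell i @: C| <= 4)%N.
Proof.
move=> small; apply: card_cell_close => p q pC qC.
have pq := le_trans (dist_le_diameter pC qC) small.
have /andP[d1 d2] := norm_sub_le_dist p q.
rewrite -2!(ler_nat R) !natrD -!lerBlDl.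
by rewrite !(le_trans (ler_norm _) (le_trans _ pq)).
Qed.

(** If the top scale is below the diameter, the count is at most its exponent, whose product with
    [ln 2] is the logarithm of that scale; otherwise the top scale adds nothing. *)
Lemma card_large_scales C (m : nat) :
  (\sum_(1 <= i < m.+1) ((2 ^ i)%N%:R < diameter R C)%R)%N%:R * ln 2
    <= ln (diameter R C).
Proof.
elim: m => [|m IH]; first by rewrite big_geq // mul0r ln_diameter_ge0.
have [large|small] := boolP ((2 ^ m.+1)%N%:R < diameter R C); last first.
  by rewrite big_nat_recr //= (negbTE small) addn0.
have p0 : 0 < (2 ^ m.+1)%N%:R :> R by rewrite ltr0n expn_gt0.
apply: le_trans (_ : m.+1%:R * ln 2 <= _).
  rewrite ler_wpM2r ?ln_ge0 ?ler1n // ler_nat.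
  (* [m.+1] becomes a sum of ones over the scales, to be compared termwise. *)
  rewrite -[leqRHS]/(m.+2 - 1)%N -[leqRHS]muln1 -sum_nat_const_nat.
  by apply: leq_sum => i _; case: (_ < _).
rewrite mulr_natl -lnXn // -natrX ler_ln ?posrE ?ltW //.
exact: lt_trans large.
Qed.

Lemma sum_card_cell_cluster C :
  (\sum_(1 <= i < k.+1) #|cell i @: C|)%N%:R * ln 2
    <= 4 * ln (2 ^ k)%N%:R + #|C|%:R * ln (diameter R C).
Proof.
have ln2 : 0 <= ln 2 :> R by rewrite ln_ge0 ?ler1n.
rewrite natrX lnXn // -(mulr_natl (ln 2)).
(* With [ln (diameter R C)] replaced by the number of large scales times [ln 2], the factor [ln 2]
   cancels. What remains is a scale-by-scale bound in [nat]: [#|C|] at large scales, 4 at the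
   others. *)
apply: le_trans (lerD (lexx _)
  (ler_wpM2l (ler0n _ _) (card_large_scales C k))).
rewrite !mulrA -mulrDl ler_wpM2r // -!natrM -natrD ler_nat.
have -> : (4 * k = \sum_(1 <= i < k.+1) 4)%N.
  by rewrite sum_nat_const_nat subn1 mulnC.
rewrite big_distrr /= -big_split.
apply: leq_sum => i _ /=.
have [large|small] := ltP (2 ^ i)%N%:R (diameter R C).
  by rewrite muln1 (leq_trans (leq_imset_card _ _)) ?leq_addl.
by rewrite muln0 addn0 card_cell_small_diameter.
Qed.

End Diameter.

Theorem theorem1 (R : realType) :
  exists2 K : R, 0 < K &
    forall (k : nat) (P : {set grid k}) (c : nat) (C : 'I_c -> {set grid k}),
      (0 < k)%N -> (0 < c)%N ->
      P = \bigcup_(i < c) C i ->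
      (num_nodes (quadtree P))%:R <=
        K * (c%:R * ln (2 ^ k)%N%:R
             + \sum_(i < c) #|C i|%:R * ln (diameter R (C i))).
Proof.
have ln2 : 0 < ln 2 :> R by rewrite ln_gt0 ?ltr1n.
(* 17 = 4 * 4 + 1: four nodes per internal node, four squares per cluster and small scale, and one
   more for the root. *)
exists (17 / ln 2); first by rewrite divr_gt0.
move=> k P c C k0 c0 ->.
set S := \sum_(i < c) _; set L := ln (2 ^ k)%N%:R.
have S0 : 0 <= S.
  by apply: sumr_ge0 => i _; rewrite mulr_ge0 ?ln_diameter_ge0.
(* Positivity of [k] and [c] lets the first term absorb the extra [+1] node. *)
have cL : ln 2 <= c%:R * L.
  rewrite /L natrX lnXn // -(mulr_natl (ln 2)) mulrA -natrM.
  by apply: ler_peMl; [exact: ltW|rewrite ler1n muln_gt0 c0].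
rewrite mulrAC ler_pdivlMr //.
set N := (\sum_(l < c) \sum_(1 <= i < k.+1) #|cell i @: C l|)%N.
have nodes : (num_nodes (quadtree (\bigcup_(i < c) C i)) <= 4 * N + 1)%N.
  rewrite addn1 (leq_trans (num_nodes_quadtree _)) // ltnS leq_mul2l /=.
  by rewrite /N exchange_big; apply: leq_sum => i _; exact: card_cell_bigcup.
have NS : N%:R * ln 2 <= 4 * (c%:R * L) + S.
  rewrite /N natr_sum mulr_suml.
  apply: (le_trans (ler_sum _ (fun l _ => sum_card_cell_cluster R (C l)))).
  by rewrite big_split /= sumr_const card_ord -(mulr_natl (4 * L)) mulrCA.
have : (num_nodes (quadtree (\bigcup_(i < c) C i)))%:R * ln 2
    <= (4 * N + 1)%N%:R * ln 2 :> R by rewrite ler_pM2r // ler_nat.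
rewrite natrD natrM; lra.
Qed.
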